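(* Let $G$ be a finite simple graph that contains none of $P_2+P_3$, $\overline{P_2+P_3}$, $K_2+K_3$ as an induced subgraph, and suppose $G$ contains an induced subgraph isomorphic to $H_1$. Then $\theta(G)\leq \alpha(G)+3$.
   Context: $P_2+P_3$ is the disjoint union of a two-vertex path and a three-vertex path, $\overline{P_2+P_3}$ its complement; $K_2+K_3$ is the disjoint union of an edge and a triangle. $H_1$ is the 7-vertex graph with vertices $v_1,v_2,v_3,v_4,a_1,a_2,a_3$ and edges $v_1v_2,v_2v_3,v_3v_4,v_4v_1$ (a 4-cycle), $a_1v_1,a_2v_2,a_3v_3$, and $a_1a_2,a_2a_3,a_1a_3$ (a triangle), and no other edges. $\alpha(G)$ is the stability number of $G$ and $\theta(G)$ is the clique covering number (minimum number of cliques needed to cover $V(G)$). *)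

(* Defs.v *)
From mathcomp Require Import all_boot.

Set Implicit Arguments.
Unset Strict Implicit.
Unset Printing Implicit Defensive.

Record sgraph := SGraph {
  vertex :> finType;
  adj : rel vertex;
  adj_sym : symmetric adj;
  adj_irr : irreflexive adj
}.

Section Constructions.
Variables G H : sgraph.

Definition compl_adj : rel G := fun x y => (x != y) && ~~ adj x y.
Lemma compl_adj_sym : symmetric compl_adj.
Proof. by move=> x y; rewrite /compl_adj eq_sym adj_sym. Qed.
Lemma compl_adj_irr : irreflexive compl_adj.
Proof. by move=> x; rewrite /compl_adj eqxx. Qed.
Definition compl : sgraph := SGraph compl_adj_sym compl_adj_irr.

Definition disjoint_union_adj : rel (G + H)%type := fun x y =>
  match x, y with
  | inl a, inl b => adj a b
  | inr a, inr b => adj a b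
  | _, _ => false
  end.
Lemma disjoint_union_adj_sym : symmetric disjoint_union_adj.
Proof. by case=> x [] y //=; exact: adj_sym. Qed.
Lemma disjoint_union_adj_irr : irreflexive disjoint_union_adj.
Proof. by case=> x /=; exact: adj_irr. Qed.
Definition disjoint_union : sgraph :=
  SGraph disjoint_union_adj_sym disjoint_union_adj_irr.

Variable S : {set G}.
Definition induced_adj : rel {x : G | x \in S} :=
  fun x y => adj (val x) (val y).
Lemma induced_adj_sym : symmetric induced_adj.
Proof. by move=> x y; exact: adj_sym. Qed.
Lemma induced_adj_irr : irreflexive induced_adj.
Proof. by move=> x; exact: adj_irr. Qed.
Definition induced : sgraph := SGraph induced_adj_sym induced_adj_irr.

End Constructions.

Definition isomorphic (G H : sgraph) : Prop :=
  exists2 f : G -> H, bijective f & forall x y, adj (f x) (f y) = adj x y.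

Definition has_induced (G H : sgraph) : Prop :=
  exists S : {set G}, isomorphic (induced S) H.

Definition path_adj (n : nat) : rel 'I_n :=
  fun i j => (i.+1 == j :> nat) || (j.+1 == i :> nat).
Lemma path_adj_sym n : symmetric (@path_adj n).
Proof. by move=> i j; rewrite /path_adj orbC. Qed.
Lemma path_adj_irr n : irreflexive (@path_adj n).
Proof. by move=> i; rewrite /path_adj orbb gtn_eqF. Qed.
Definition path_graph (n : nat) : sgraph :=
  SGraph (@path_adj_sym n) (@path_adj_irr n).

Definition complete_adj (n : nat) : rel 'I_n := fun i j => i != j.
Lemma complete_adj_sym n : symmetric (@complete_adj n).
Proof. by move=> i j; rewrite /complete_adj eq_sym. Qed.
Lemma complete_adj_irr n : irreflexive (@complete_adj n).
Proof. by move=> i; rewrite /complete_adj eqxx. Qed.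
Definition complete_graph (n : nat) : sgraph :=
  SGraph (@complete_adj_sym n) (@complete_adj_irr n).

(* Vertices 0, 1, 2, 3 stand for v_1, v_2, v_3, v_4 and 4, 5, 6 for
   a_1, a_2, a_3. *)
Definition H1_edges : seq (nat * nat) :=
  [:: (0, 1); (1, 2); (2, 3); (3, 0);
      (4, 0); (5, 1); (6, 2);
      (4, 5); (5, 6); (4, 6)].
Definition H1_adj : rel 'I_7 := fun i j =>
  ((i : nat, j : nat) \in H1_edges) || ((j : nat, i : nat) \in H1_edges).
Lemma H1_adj_sym : symmetric H1_adj.
Proof. by move=> i j; rewrite /H1_adj orbC. Qed.
Lemma H1_adj_irr : irreflexive H1_adj.
Proof. by case; do 7?[case=> //]. Qed.
Definition H1 : sgraph := SGraph H1_adj_sym H1_adj_irr.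

Definition P2_P3 : sgraph := disjoint_union (path_graph 2) (path_graph 3).
Definition K2_K3 : sgraph :=
  disjoint_union (complete_graph 2) (complete_graph 3).

Section Invariants.
Variable G : sgraph.

Definition stable (S : {set G}) : bool :=
  [forall x in S, forall y in S, ~~ adj x y].
Definition stability_number : nat := \max_(S : {set G} | stable S) #|S|.

Definition clique (S : {set G}) : bool :=
  [forall x in S, forall y in S, (x != y) ==> adj x y].
Definition clique_cover (P : {set {set G}}) : bool :=
  [forall K in P, clique K] && (cover P == [set: G]).

Definition singletons : {set {set G}} := [set [set x] | x in G].
Lemma clique_cover_singletons : clique_cover singletons.
Proof.
apply/andP; split.
  apply/forall_inP=> _ /imsetP[x _ ->].
  apply/forall_inP=> y /set1P->; apply/forall_inP=> z /set1P->.
  by rewrite eqxx.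
apply/eqP/setP=> x; rewrite inE; apply/bigcupP.
by exists [set x]; [exact: imset_f | exact: set11].
Qed.

(* The starting point of the arg min is admissible by the preceding lemma,
   so this is the least cardinality of a clique cover. *)
Definition clique_cover_number : nat :=
  #|[arg min_(P < singletons | clique_cover P) #|P| ]|.

End Invariants.

(* Main.v *)
Require Import Defs.
From mathcomp Require Import all_boot.

(** Fix an induced copy of [H1] and sort the other vertices by their
    neighbourhood in it.  Only 18 neighbourhoods are compatible with the three
    forbidden graphs.  Let [W] be the set of vertices whose neighbourhood is
    empty, [{v3, a1}], [{v1, a3}] or [{v1, v3, a2}].  Each of these four classes
    is stable, any two of them are joined by a matching, and the first one sees
    only the last; so [W] is eaten up by simplicial vertices and induced
    6-cycles, which gives theta(W) = alpha(W).  Neither [v2] nor [v4] has a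
    neighbour in [W], hence alpha(G) >= alpha(W) + 2.  Finally the vertices
    outside [W] are covered by 5 cliques, each a union of neighbourhood classes
    and vertices of [H1]: two vertices in the same clique are adjacent because
    otherwise they would create a forbidden graph together with [H1]. *)

Set Implicit Arguments.
Unset Strict Implicit.
Unset Printing Implicit Defensive.

(** * Adjacency matrices of vertex sequences *)

(* A graph on a sequence of vertices is encoded by its strictly lower
   triangular adjacency matrix: row i lists the adjacencies of the i-th vertex
   to the earlier ones, so adding a vertex appends a row. *)
Section Rows.
Variables (T : Type) (e : rel T).

Fixpoint tri (t s : seq T) : seq (seq bool) :=
  if s is x :: s' then [seq e x y | y <- t] :: tri (rcons t x) s' else [::].

Lemma size_tri t s : size (tri t s) = size s.
Proof. by elim: s t => //= x s IH t; rewrite IH. Qed.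

Lemma tri_cat t s1 s2 : tri t (s1 ++ s2) = tri t s1 ++ tri (t ++ s1) s2.
Proof.
elim: s1 t => [|x s1 IH] t /=; first by rewrite cats0.
by rewrite IH cat_rcons.
Qed.

Lemma nth_tri x0 t s i j : i < size s -> j < size t + i ->
  nth false (nth [::] (tri t s) i) j = e (nth x0 s i) (nth x0 (t ++ s) j).
Proof.
elim: s t i => [|x s IH] t [|i] //= lis ljt.
  by rewrite addn0 in ljt; rewrite (nth_map x0) // nth_cat ljt.
by rewrite IH ?size_rcons ?addSnnS // cat_rcons.
Qed.

End Rows.

(** [P] allows maps that respect adjacency only on part of [T], such as [nth] on valid indices. *)
Lemma tri_map (T T' : Type) (e : rel T) (e' : rel T') (f : T -> T')
    (P : pred T) t s :
  (forall x y, P x -> P y -> e' (f x) (f y) = e x y) ->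
  all P t -> all P s -> tri e' (map f t) (map f s) = tri e t s.
Proof.
move=> ef; elim: s t => //= x s IH t Pt /andP[Px Ps].
rewrite -map_rcons IH ?all_rcons ?Px // -map_comp; congr (_ :: _).
by elim: t Pt {IH} => //= y t IHt /andP[Py Pt]; rewrite IHt // ef.
Qed.

Definition edge (rows : seq (seq bool)) (i j : nat) : bool :=
  if j < i then nth false (nth [::] rows i) j
  else if i < j then nth false (nth [::] rows j) i else false.

(* Backtracking search for vertices that, placed after [t], realise the rows
   [p] as an induced subgraph of [rows]. *)
Fixpoint extends (rows p : seq (seq bool)) (t : seq nat) : bool :=
  if p is r :: p' then
    has (fun v => if (v \notin t) && ([seq edge rows v w | w <- t] == r)
                  then extends rows p' (rcons t v) else false)
        (iota 0 (size rows))
  else true.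

Lemma extendsP rows p t : uniq t -> extends rows p t ->
  exists u, [/\ uniq (t ++ u), all (gtn (size rows)) u
              & tri (edge rows) t u = p].
Proof.
elim: p t => [|r p IH] t ut /=; first by exists [::]; rewrite cats0.
case/hasP=> v; rewrite mem_iota add0n => /= lv.
case: ifP => // /andP[vt /eqP <-] /IH; rewrite rcons_uniq vt.
case=> // u [uu lu <-]; exists (v :: u); split=> //=.
  by rewrite -cat_rcons.
by rewrite lv.
Qed.

(** * From matrices to induced subgraphs *)

Section Induced.
Variable G : sgraph.

Lemma edge_tri x0 (s : seq G) i j : i < size s -> j < size s ->
  edge (tri (@adj G) [::] s) i j = adj (nth x0 s i) (nth x0 s j).
Proof.
move=> li lj; rewrite /edge; case: ltngtP => [ji|ij|<-].
- by rewrite (nth_tri _ x0).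
- by rewrite (nth_tri _ x0) // adj_sym.
by rewrite adj_irr.
Qed.

(** The image of [f] is the induced copy: an injection onto a set of equal cardinality is
    bijective. *)
Lemma has_induced_inj (H : sgraph) (f : H -> G) :
  injective f -> (forall x y, adj (f x) (f y) = adj x y) -> has_induced G H.
Proof.
move=> fI fE; exists (f @: H).
pose k (x : H) : induced (f @: H) := exist _ (f x) (imset_f f (erefl true)).
have kI : injective k by move=> x y /(congr1 val) /fI.
have [|k' kK k'K] := inj_card_bij kI.
  by rewrite card_sig (card_imset _ fI).
exists k'; first by exists k.
by move=> x y; rewrite -fE -{2}(k'K x) -{2}(k'K y).
Qed.

End Induced.

(** As [l] lists every vertex of [H], sending a vertex to the entry of [u] at its index in [l] is an
    induced embedding. *)
Lemma has_induced_tri (G H : sgraph) (x0 : G) (l : seq H) (u : seq G) :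
  (forall x, x \in l) -> uniq u ->
  tri (@adj G) [::] u = tri (@adj H) [::] l -> has_induced G H.
Proof.
move=> lT uu E; have sz : size u = size l.
  by rewrite -(size_tri (@adj G) [::] u) E size_tri.
have ltl x : index x l < size u by rewrite sz index_mem.
apply: (@has_induced_inj G H (fun x => nth x0 u (index x l))) => x y.
  by move/eqP; rewrite nth_uniq // => /eqP /index_inj; apply.
by rewrite -edge_tri // E (edge_tri x) -?sz // !nth_index.
Qed.

(** Carries what the search finds on indices back to vertices of [G]. *)
Lemma tri_extends (G : sgraph) (x0 : G) (s : seq G) p :
  uniq s -> extends (tri (@adj G) [::] s) p [::] ->
  exists2 u : seq G, uniq u & tri (@adj G) [::] u = p.
Proof.
move=> us /extendsP[] // u [/= uu]; rewrite size_tri => /allP lu <-.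
exists [seq nth x0 s i | i <- u].
  rewrite map_inj_in_uniq // => i j iu ju /eqP.
  by rewrite nth_uniq => [/eqP| | |] //; [exact: (lu i) | exact: (lu j)].
rewrite -[[::]]/(map (nth x0 s) [::]).
apply: (@tri_map _ _ _ _ _ (gtn (size s))) => //; last exact/allP.
by move=> i j /= li lj; rewrite (edge_tri x0).
Qed.

(** * Finite computations on neighbourhoods in [H1] *)

Definition P2_P3_vertices : seq P2_P3 :=
  [:: inl (@Ordinal 2 0 isT); inl (@Ordinal 2 1 isT);
      inr (@Ordinal 3 0 isT); inr (@Ordinal 3 1 isT); inr (@Ordinal 3 2 isT)].

Lemma mem_P2_P3_vertices x : x \in P2_P3_vertices.
Proof. by case: x => [] [[|[|[|]]]]. Qed.

Definition P2_P3_rows := Eval vm_compute in tri (@adj P2_P3) [::] P2_P3_vertices.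
(** The three forbidden graphs share one vertex type, so the same enumeration serves them all. *)
Definition co_P2_P3_rows :=
  Eval vm_compute in tri (@adj (compl P2_P3)) [::] P2_P3_vertices.
Definition K2_K3_rows :=
  Eval vm_compute in tri (@adj K2_K3) [::] P2_P3_vertices.
Definition H1_vertices : seq H1 :=
  [:: @Ordinal 7 0 isT; @Ordinal 7 1 isT; @Ordinal 7 2 isT; @Ordinal 7 3 isT;
      @Ordinal 7 4 isT; @Ordinal 7 5 isT; @Ordinal 7 6 isT].
Definition H1_rows := Eval vm_compute in tri (@adj H1) [::] H1_vertices.

Definition good (rows : seq (seq bool)) : bool :=
  ~~ has (fun p => extends rows p [::])
         [:: P2_P3_rows; co_P2_P3_rows; K2_K3_rows].

(* Neighbourhoods in H1: 0, 1, 2, 3 are v1, v2, v3, v4 and 4, 5, 6 are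
   a1, a2, a3. *)
Definition nbh (l : seq nat) : seq bool := [seq i \in l | i <- iota 0 7].

Definition W_types : seq (seq bool) :=
  map nbh [:: [::]; [:: 2; 4]; [:: 0; 6]; [:: 0; 2; 5]].

Definition T_types : seq (seq bool) :=
  map nbh [:: iota 0 7; [:: 1]; [:: 1; 2; 4]; [:: 3; 5]; [:: 0; 3; 5];
              [:: 2; 3; 5]; [:: 3; 4; 5]; [:: 0; 1; 6]; [:: 0; 2; 4; 6];
              [:: 3; 4; 6]; [:: 0; 3; 4; 6]; [:: 2; 3; 4; 6]; [:: 3; 5; 6];
              [:: 3; 4; 5; 6]].

Fixpoint bitseqs (n : nat) : seq (seq bool) :=
  if n is m.+1 then map (cons true) (bitseqs m) ++ map (cons false) (bitseqs m)
  else [:: [::]].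

Lemma mem_bitseqs (l : seq bool) : l \in bitseqs (size l).
Proof.
by elim: l => //= -[] l IH; rewrite mem_cat map_f ?orbT.
Qed.

Definition good1 t := good (H1_rows ++ [:: t]).
(** The bits are the adjacencies among the vertices added to [H1]: [e] second to first, [f] third to
    first, [g] third to second. *)
Definition good2 t u e := good (H1_rows ++ [:: t; rcons u e]).
Definition good3 t u v e f g :=
  good (H1_rows ++ [:: t; rcons u e; rcons (rcons v f) g]).

Lemma good1_types :
  all (fun t => good1 t ==> (t \in W_types ++ T_types)) (bitseqs 7).
Proof. by vm_compute. Qed.

Lemma good2_W_stable : all (fun t => ~~ good2 t t true) W_types.
Proof. by vm_compute. Qed.

Lemma good2_W_empty :
  all (fun t => good2 (nbh [::]) t true ==> (t == nbh [:: 0; 2; 5])) W_types.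
Proof. by vm_compute. Qed.

(** The bits describe a vertex with two nonadjacent neighbours of the same type. *)
Lemma good3_W_matching :
  all (fun t => all (fun u => ~~ good3 t u u true true false) W_types) W_types.
Proof. by vm_compute. Qed.

(* A pair (I, T) stands for the vertices of H1 with index in I and the vertices
   outside H1 whose neighbourhood is in T. *)
Definition good_class (c : seq nat * seq (seq nat)) : bool :=
  let T := map nbh c.2 in
  [&& all (fun i => all (fun j => (i == j) || edge H1_rows i j) c.1) c.1,
      all (fun i => all (fun t => nth false t i) T) c.1
    & all (fun t => all (fun u => ~~ good2 t u false) T) T].

(* No single list of 5 classes covers all 14 neighbourhoods of [T_types]; the
   three lists are for graphs without a vertex of neighbourhood {v4, a1, a2},
   without one of neighbourhood {v4, a2, a3}, and with both. *)
Definition cover_no_345 : seq (seq nat * seq (seq nat)) :=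
  [:: ([:: 1; 2], [:: [:: 1; 2; 4]; iota 0 7]);
      ([:: 0; 3], [:: [:: 0; 3; 4; 6]]);
      ([::], [:: [:: 1]; [:: 3; 5; 6]; [:: 3; 4; 6]; [:: 2; 3; 4; 6];
                 [:: 3; 4; 5; 6]]);
      ([::], [:: [:: 3; 5]; [:: 2; 3; 5]; [:: 0; 1; 6]; [:: 0; 3; 5];
                 [:: 0; 2; 4; 6]]);
      ([:: 4; 5; 6], [::])].

Definition cover_no_356 : seq (seq nat * seq (seq nat)) :=
  [:: ([:: 0; 1], [:: [:: 0; 1; 6]; iota 0 7]);
      ([:: 2; 3], [:: [:: 2; 3; 4; 6]]);
      ([::], [:: [:: 1]; [:: 3; 4; 5]; [:: 3; 4; 6]; [:: 0; 3; 4; 6];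
                 [:: 3; 4; 5; 6]]);
      ([::], [:: [:: 3; 5]; [:: 0; 3; 5]; [:: 1; 2; 4]; [:: 2; 3; 5];
                 [:: 0; 2; 4; 6]]);
      ([:: 4; 5; 6], [::])].

Definition cover_both : seq (seq nat * seq (seq nat)) :=
  [:: ([:: 0; 1], [:: iota 0 7]);
      ([:: 2; 6], [::]);
      ([:: 4; 5], [:: [:: 3; 4; 5]]);
      ([::], [:: [:: 1]; [:: 3; 5; 6]]);
      ([:: 3], [:: [:: 3; 5]; [:: 0; 3; 5]; [:: 2; 3; 5]])].

Lemma good_covers :
  all (all good_class) [:: cover_no_345; cover_no_356; cover_both].
Proof. by vm_compute. Qed.

Definition in_types (cs : seq (seq nat * seq (seq nat))) (t : seq bool) :=
  has (fun c => t \in map nbh c.2) cs.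

Definition in_base (cs : seq (seq nat * seq (seq nat))) (i : nat) :=
  has (fun c => i \in c.1) cs.

Lemma covers_base :
  all (fun cs => all (in_base cs) (iota 0 7))
      [:: cover_no_345; cover_no_356; cover_both].
Proof. by vm_compute. Qed.

(** In the last check the adjacency to each special vertex is unknown, so a type counts as
    compatible if either value is. *)
Lemma covers_types :
  [&& all (fun t => (t != nbh [:: 3; 4; 5]) ==> in_types cover_no_345 t) T_types,
      all (fun t => (t != nbh [:: 3; 5; 6]) ==> in_types cover_no_356 t) T_types
    & all (fun t => has (good2 (nbh [:: 3; 4; 5]) t) [:: true; false] &&
                    has (good2 (nbh [:: 3; 5; 6]) t) [:: true; false]
                    ==> in_types cover_both t) T_types].
Proof. by vm_compute. Qed.

(** * Clique covers built by successive reductions *)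

Section Cover.
Variable G : sgraph.
Implicit Types (W X K : {set G}) (s : seq {set G}).

Definition covers s W := forall x, x \in W -> has (fun K => x \in K) s.

Lemma cliqueP K :
  reflect {in K &, forall x y, x != y -> adj x y} (clique K).
Proof.
apply: (iffP forall_inP) => [H x y xK yK|H x xK].
  by move/(_ x xK)/forall_inP/(_ y yK)/implyP: H.
by apply/forall_inP=> y yK; apply/implyP; apply: H.
Qed.

Lemma stableP X : reflect {in X &, forall x y, ~~ adj x y} (stable X).
Proof.
apply: (iffP forall_inP) => [H x y xK yK|H x xK].
  by move/(_ x xK)/forall_inP/(_ y yK): H.
by apply/forall_inP=> y yK; apply: H.
Qed.

Lemma clique2 (x y : G) : adj x y -> clique [set x; y].
Proof.
move=> xy; apply/cliqueP=> u v /set2P[]-> /set2P[]->; rewrite ?eqxx //.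
by rewrite adj_sym.
Qed.

(** Turning the sequence into a set merges repeated cliques, which can only lower the count. *)
Lemma clique_cover_number_le s :
  all (@clique G) s -> covers s [set: G] -> clique_cover_number G <= size s.
Proof.
move=> sC sG; rewrite /clique_cover_number.
case: arg_minnP => [|P _ minP]; first exact: clique_cover_singletons.
apply: leq_trans (minP [set K in s] _) _; last first.
  by rewrite cardsE card_size.
apply/andP; split.
  by apply/forall_inP=> K; rewrite inE => /(allP sC).
apply/eqP/setP=> x; rewrite inE; apply/bigcupP.
by have /hasP[K Ks xK] := sG x (in_setT x); exists K; rewrite ?inE.
Qed.

Lemma stability_number_ge X : stable X -> #|X| <= stability_number G.
Proof.
by move=> sX; rewrite /stability_number (bigmax_sup X).
Qed.

(* Deleting the cliques of [s] from [W] lowers the clique covering number by at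
   most [#|X|] and the stability number by at least [#|X|]. *)
Definition reducible W X s :=
  [/\ X != set0, X \subset W, stable X, all (@clique G) s & size s = #|X|] /\
  forall x y, x \in X -> y \in W -> (y == x) || adj x y ->
    has (fun K => y \in K) s.

Lemma reducible_cover W0 :
  (forall W, W \subset W0 -> W != set0 -> exists X s, reducible W X s) ->
  forall W, W \subset W0 ->
  exists X s, [/\ X \subset W, stable X, all (@clique G) s, covers s W
                & size s = #|X|].
Proof.
move=> red W; have [n] := ubnP #|W|; elim: n W => // n IH W; rewrite ltnS => ltW WW0.
have [->|W0n] := eqVneq W set0.
  exists set0, [::]; split=> //; last by rewrite cards0.
    by apply/stableP=> x y; rewrite inE.
  by move=> x; rewrite inE.
have [X [s [[X0 XW Xst sC sX] sN]]] := red W WW0 W0n.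
pose W' := [set x in W | ~~ has (fun K => x \in K) s].
have W'W : W' \subset W by apply/subsetP=> x; rewrite inE => /andP[].
have XW' x : x \in X -> x \notin W'.
  move=> xX; rewrite inE negb_and negbK (sN x x) ?eqxx ?orbT //.
  exact: subsetP XW _ xX.
have ltW' : #|W'| < n.
  apply: leq_trans ltW; apply/proper_card/properP; split=> //.
  have [x xX] := set0Pn _ X0; exists x; first exact: subsetP XW _ xX.
  exact: XW'.
have [X' [s' [X'W' X'st s'C s'W s'X]]] := IH _ ltW' (subset_trans W'W WW0).
(* Neighbours of [X] in [W] are covered by [s], hence absent from [W']; so the two stable sets can
   be united. *)
have XX' x y : x \in X -> y \in X' -> ~~ adj x y.
  move=> xX /(subsetP X'W'); rewrite inE => /andP[yW]; apply: contra => xy.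
  by apply: (sN x) => //; rewrite xy orbT.
exists (X :|: X'), (s ++ s'); split.
- by rewrite subUset XW (subset_trans X'W').
- apply/stableP=> x y /setUP[] xX /setUP[] yX.
  + by move/stableP: Xst; apply.
  + exact: XX'.
  + by rewrite adj_sym XX'.
  + by move/stableP: X'st; apply.
- by rewrite all_cat sC.
- move=> x xW; rewrite has_cat; case: (boolP (has _ s)) => //= xs.
  by apply: s'W; rewrite inE xW.
rewrite size_cat sX s'X cardsU disjoint_setI0 ?cards0 ?subn0 //.
apply/pred0P=> x /=; apply/negP=> /andP[/XW' xW' /(subsetP X'W') xW].
by rewrite xW in xW'.
Qed.

(** The closed neighbourhood of [x] in [W] is the single clique to delete. *)
Lemma simplicial_reducible W x :
  x \in W ->
  (forall y z, y \in W -> z \in W -> adj x y -> adj x z -> y != z -> adj y z) ->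
  exists X s, reducible W X s.
Proof.
move=> xW xN; exists [set x], [:: [set y in W | (y == x) || adj x y]].
split; last by move=> _ y /set1P-> yW xy; rewrite /= inE yW xy.
split=> //=; rewrite ?sub1set ?cards1 //.
- by apply/set0Pn; exists x; rewrite set11.
- by apply/stableP=> u v /set1P-> /set1P->; rewrite adj_irr.
rewrite andbT; apply/cliqueP=> y z; rewrite !inE.
move=> /andP[yW /predU1P[->|xy]] /andP[zW /predU1P[->|xz]]; rewrite ?eqxx //.
  by rewrite adj_sym.
exact: xN.
Qed.

End Cover.

(** * Stable classes joined by matchings *)

Section Matchings.
Variables (G : sgraph) (K : eqType) (W0 : {set G}) (ty : G -> K).
Variables (z0 c0 : K) (ks : seq K).
Hypothesis P2_P3_free : ~ has_induced G P2_P3.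
Hypothesis ks3 : size ks = 3.
Hypothesis tyW0 : forall x, x \in W0 -> ty x \in z0 :: ks.
Hypothesis ty_stable : {in W0 &, forall x y, adj x y -> ty x != ty y}.
Hypothesis ty_matching : forall x y z, x \in W0 -> y \in W0 -> z \in W0 ->
  adj x y -> adj x z -> ty y = ty z -> y = z.
Hypothesis ty_leaf :
  {in W0 &, forall x y, adj x y -> ty x = z0 -> ty y = c0}.

Lemma no_P2_P3 x0 x1 x2 x3 x4 : uniq [:: x0; x1; x2; x3; x4] ->
  tri (@adj G) [::] [:: x0; x1; x2; x3; x4] = P2_P3_rows -> False.
Proof.
move=> u E; apply: P2_P3_free.
exact: (has_induced_tri x0 mem_P2_P3_vertices u).
Qed.

(** Pigeonhole: otherwise [ks] would have four distinct entries. *)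
Lemma third_type (a b c d : K) : a \in ks -> b \in ks -> c \in ks ->
  d \in ks -> a != b -> a != c -> b != c -> d != a -> d != b -> d = c.
Proof.
move=> aK bK cK dK ab ac bc da db; apply/eqP/negPn/negP=> dc.
have: size [:: d; a; b; c] <= size ks.
  apply: uniq_leq_size; first by rewrite /= !inE !negb_or da db dc ab ac bc.
  by move=> k; rewrite !inE => /or4P[] /eqP->.
by rewrite ks3.
Qed.

(** Without a simplicial vertex, each vertex of [W] has exactly one neighbour in each of the two
    other classes of [ks]; excluding P2 + P3 then puts [x] on an induced 6-cycle that has no further
    neighbours in [W]. *)
Lemma matching_reducible (W : {set G}) : W \subset W0 -> W != set0 ->
  exists X s, reducible W X s.
Proof.
move=> /subsetP sW /set0Pn[x xW].
have [/existsP[u /andP[uW /forall_inP uN]]|/existsPn nsim] :=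
  boolP [exists u, (u \in W) && [forall y in W, forall z in W,
    [&& adj u y, adj u z & y != z] ==> adj y z]].
  apply: (simplicial_reducible uW) => y z yW zW uy uz yz.
  have /forall_inP/(_ z zW)/implyP := uN y yW.
  by apply; rewrite uy uz yz.
have {}nsim u : u \in W -> exists y z,
    [/\ y \in W, z \in W & [/\ adj u y, adj u z, y != z & ~~ adj y z]].
  move=> uW; have := nsim u; rewrite uW /= => /forall_inPn[y yW].
  case/forall_inPn=> z zW; rewrite negb_imply => /andP[/and3P[uy uz yz] nyz].
  by exists y, z.
have neqty u y z : u \in W -> y \in W -> z \in W -> adj u y -> adj u z ->
    y != z -> ty y != ty z.
  move=> uW yW zW uy uz; apply: contra => /eqP tyz; apply/eqP.
  exact: ty_matching (sW _ uW) (sW _ yW) (sW _ zW) uy uz tyz.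
(* The two neighbours of a vertex of type [z0] would both have type [c0], against [neqty]. *)
have tyks u : u \in W -> ty u \in ks.
  move=> uW; have := tyW0 (sW _ uW); rewrite inE => /predU1P[uz0|//].
  have [y [z [yW zW [uy uz yz _]]]] := nsim u uW.
  have := neqty u y z uW yW zW uy uz yz.
  by rewrite (ty_leaf (sW _ uW) (sW _ yW) uy uz0)
             (ty_leaf (sW _ uW) (sW _ zW) uz uz0) eqxx.
(* The two neighbours from [nsim] have distinct types other than [ty u], so they take up both
   remaining types. *)
have nbr u k : u \in W -> k \in ks -> k != ty u ->
    exists y, [/\ y \in W, adj u y & ty y = k].
  move=> uW kK ku; have [y [z [yW zW [uy uz yz _]]]] := nsim u uW.
  have [yk|yk] := eqVneq (ty y) k; first by exists y.
  exists z; split=> //; apply/esym.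
  apply: (@third_type (ty u) (ty y)); rewrite ?tyks //; last by rewrite eq_sym.
  - by apply: ty_stable uy; apply: sW.
  - by apply: ty_stable uz; apply: sW.
  - exact: neqty uy uz yz.
have tyN u y : u \in W -> y \in W -> adj u y -> ty u != ty y.
  by move=> uW yW; apply: ty_stable; apply: sW.
have matW u y z : u \in W -> y \in W -> z \in W ->
    adj u y -> adj u z -> ty y = ty z -> y = z.
  by move=> uW yW zW; apply: ty_matching; apply: sW.
have [y [z [yW zW [xy xz yz nyz]]]] := nsim x xW.
have txy := tyN _ _ xW yW xy; have txz := tyN _ _ xW zW xz.
have tyz := neqty _ _ _ xW yW zW xy xz yz.
have [z' [z'W yz' tz']] : exists z', [/\ z' \in W, adj y z' & ty z' = ty z].
  by apply: nbr; rewrite ?tyks // eq_sym.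
have [y' [y'W zy' ty']] : exists y', [/\ y' \in W, adj z y' & ty y' = ty y].
  by apply: nbr; rewrite ?tyks.
have [x' [x'W yx' tx']] : exists x', [/\ x' \in W, adj y' x' & ty x' = ty x].
  by apply: nbr; rewrite ?tyks // ty'.
have nzz : z' != z by apply: contraNneq nyz => <-.
have nyy : y' != y by apply: contraNneq nyz => <-; rewrite adj_sym.
have nxx : x' != x.
  apply: contraNneq nyy => x'x; rewrite (matW x y' y) ?xy //.
  by rewrite -x'x adj_sym.
have same u v : u \in W -> v \in W -> ty u = ty v -> adj u v = false.
  by move=> uW vW uv; apply/negP=> /(tyN _ _ uW vW); rewrite uv eqxx.
have nadj u v w : u \in W -> v \in W -> w \in W -> adj u v -> ty v = ty w ->
    v != w -> adj w u = false.
  move=> uW vW wW uv vw; apply: contraNF => wu; apply/eqP.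
  by apply: (matW u); rewrite // adj_sym.
have neq u v : ty u != ty v -> u != v by apply: contra => /eqP->.
have y'z' : adj y' z' = false.
  by rewrite adj_sym (nadj y' z z') // 1?adj_sym // eq_sym.
have x'y : adj x' y = false by rewrite (nadj y x x') // 1?adj_sym // eq_sym.
have x'z : adj x' z = false by rewrite (nadj z x x') // 1?adj_sym // eq_sym.
have xy' : adj x y' = false by rewrite adj_sym (nadj x y y') // eq_sym.
have xz' : adj x z' = false by rewrite adj_sym (nadj x z z') // eq_sym.
have ny'z' : y' != z' by rewrite neq // ty' tz'.
(* The vertices z', y, x, z, y', x' form a path; if it did not close up to a
   6-cycle, then y z' and z y' x' would induce P2 + P3. *)
have z'x' : adj z' x'.
  apply/negPn/negP=> /negbTE nz'x'; apply: (@no_P2_P3 y z' z y' x').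
    rewrite /= !inE !negb_or yz nzz ![_ == y']eq_sym nyy ny'z' !neq //;
      by rewrite ?ty' ?tx' ?tz' // eq_sym.
  rewrite /= y'z' x'y x'z [adj x' z']adj_sym nz'x' [adj z' y]adj_sym yz'.
  rewrite [adj z y]adj_sym (negbTE nyz) (same z z') // (same y' y) //.
  by rewrite [adj y' z]adj_sym zy' [adj x' y']adj_sym yx'.
(* A third neighbour of [u] would repeat the type of [p] or [q]. *)
have nb u p q v : u \in W -> p \in W -> q \in W -> v \in W ->
    adj u p -> adj u q -> ty p != ty q -> adj u v -> v = p \/ v = q.
  move=> uW pW qW vW up uq pq uv.
  have [vp|vp] := eqVneq (ty v) (ty p); first by left; apply: matW uv up vp.
  right; apply: (matW u) => //.
  apply: (@third_type (ty u) (ty p)); rewrite ?tyks //; try exact: tyN.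
  by rewrite eq_sym; apply: tyN.
(* Alternate vertices of the 6-cycle, and a perfect matching of it. *)
exists [set x; y'; z'], [:: [set y; z']; [set x; z]; [set y'; x']]; split.
  split=> /=; rewrite ?clique2 //.
  - by apply/set0Pn; exists x; rewrite !inE eqxx.
  - by apply/subsetP=> u; rewrite !inE => /orP[/orP[]|] /eqP->.
  - apply/stableP=> u v; rewrite !inE.
    by move=> /orP[/orP[]|] /eqP-> /orP[/orP[]|] /eqP->;
       rewrite ?adj_irr // ?xy' ?xz' ?y'z' // adj_sym ?xy' ?xz' ?y'z'.
  - rewrite setUC cardsU1 cards2 !inE negb_or ![z' == _]eq_sym ny'z'.
    by rewrite !neq // ?tz' ?ty'.
move=> u v; rewrite !inE => /orP[/orP[]|] /eqP-> vW /predU1P[->|];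
  rewrite /= ?inE ?eqxx ?orbT //.
- by case/(nb _ y z) => // ->; rewrite eqxx ?orbT.
- by case/(nb _ z x') => // [||->|->]; rewrite ?eqxx ?orbT ?tx' // 1?adj_sym // eq_sym.
- by case/(nb _ y x') => // [||->|->]; rewrite ?eqxx ?orbT ?tx' // 1?adj_sym // eq_sym.
Qed.

End Matchings.

(** * Classes of vertices around a fixed copy of [H1] *)

Section Free.
Variables (G : sgraph) (x0 : G) (hs : seq G).
Hypothesis P2_P3_free : ~ has_induced G P2_P3.
Hypothesis co_P2_P3_free : ~ has_induced G (compl P2_P3).
Hypothesis K2_K3_free : ~ has_induced G K2_K3.
Hypothesis hs_uniq : uniq hs.
Hypothesis hs_rows : tri (@adj G) [::] hs = H1_rows.

Lemma good_tri (s : seq G) : uniq s -> good (tri (@adj G) [::] s).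
Proof.
move=> us; apply/hasPn=> p; rewrite !inE => /or3P[] /eqP->;
  apply/negP=> /(tri_extends x0 us)[u uu E].
- exact: P2_P3_free (has_induced_tri x0 mem_P2_P3_vertices uu E).
- apply: co_P2_P3_free.
  exact: (@has_induced_tri G (compl P2_P3) x0 _ u mem_P2_P3_vertices uu E).
apply: K2_K3_free.
exact: (@has_induced_tri G K2_K3 x0 _ u mem_P2_P3_vertices uu E).
Qed.

Definition ty (x : G) : seq bool := [seq adj x y | y <- hs].

Lemma size_hs : size hs = 7.
Proof. by rewrite -(size_tri (@adj G) [::]) hs_rows. Qed.

Lemma nth_ty x i : i < 7 -> nth false (ty x) i = adj x (nth x0 hs i).
Proof. by move=> li; rewrite (nth_map x0) ?size_hs. Qed.

Lemma adj_hs i j : i < 7 -> j < 7 ->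
  adj (nth x0 hs i) (nth x0 hs j) = edge H1_rows i j.
Proof. by move=> li lj; rewrite -hs_rows (edge_tri x0) ?size_hs. Qed.

Lemma ty_good1 x : x \notin hs -> good1 (ty x).
Proof.
move=> xh; have := @good_tri (rcons hs x).
by rewrite rcons_uniq xh hs_uniq -cats1 tri_cat hs_rows; apply.
Qed.

Lemma ty_good2 x y : x \notin hs -> y \notin hs -> y != x ->
  good2 (ty x) (ty y) (adj y x).
Proof.
move=> xh yh yx; have := @good_tri (rcons (rcons hs x) y).
rewrite !rcons_uniq mem_rcons inE negb_or yx yh xh hs_uniq.
by rewrite -!cats1 -catA tri_cat hs_rows /= map_rcons; apply.
Qed.

Lemma ty_good3 x y z : x \notin hs -> y \notin hs -> z \notin hs ->
  y != x -> z != x -> z != y ->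
  good3 (ty x) (ty y) (ty z) (adj y x) (adj z x) (adj z y).
Proof.
move=> xh yh zh yx zx zy; have := @good_tri (rcons (rcons (rcons hs x) y) z).
rewrite !rcons_uniq !mem_rcons !inE !mem_rcons !inE !negb_or.
rewrite yx zx zy xh yh zh hs_uniq.
by rewrite -!cats1 -!catA tri_cat hs_rows /= !map_rcons; apply.
Qed.

Definition class_set (c : seq nat * seq (seq nat)) : {set G} :=
  [set x | if x \in hs then index x hs \in c.1 else ty x \in map nbh c.2].

(** Adjacencies within and towards the copy are read off [H1_rows] and the types; two outside
    vertices are adjacent because [good2] rejects the alternative. *)
Lemma clique_class_set c : good_class c -> clique (class_set c).
Proof.
have idx x : x \in hs -> index x hs < 7 by rewrite -size_hs index_mem.
case/and3P=> /allP cH /allP cHT /allP cT; apply/cliqueP=> x y.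
rewrite !inE; case: ifPn => xh xc; case: ifPn => yh yc xy.
- have /allP/(_ _ yc)/predU1P[/index_inj eqxy|] := cH _ xc.
    by rewrite eqxy // eqxx in xy.
  by rewrite -adj_hs ?idx // !nth_index.
- have /allP/(_ _ yc) := cHT _ xc.
  by rewrite nth_ty ?idx // nth_index // adj_sym.
- have /allP/(_ _ xc) := cHT _ yc.
  by rewrite nth_ty ?idx // nth_index.
apply: contraTT (ty_good2 yh xh xy) => /negbTE->.
by have /allP/(_ _ xc) := cT _ yc.
Qed.

Lemma ty_types x : x \notin hs -> ty x \in W_types ++ T_types.
Proof.
move=> xh; have /allP/(_ (ty x)) := good1_types.
rewrite ty_good1 //; apply.
by have := mem_bitseqs (ty x); rewrite size_map size_hs.
Qed.

Lemma five_classes : exists2 cs,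
  cs \in [:: cover_no_345; cover_no_356; cover_both] &
  forall x, x \notin hs -> ty x \in T_types -> in_types cs (ty x).
Proof.
have has_bool (p : pred bool) e : p e -> has p [:: true; false].
  by case: e => /= ->; rewrite ?orbT.
case/and3P: covers_types => /allP c345 /allP c356 /allP cboth.
have [/existsP[y /andP[yh /eqP yt]]|/existsPn no345] :=
  boolP [exists y, (y \notin hs) && (ty y == nbh [:: 3; 4; 5])]; last first.
  exists cover_no_345 => // x xh /c345/implyP; apply.
  by have := no345 x; rewrite xh.
have [/existsP[z /andP[zh /eqP zt]]|/existsPn no356] :=
  boolP [exists y, (y \notin hs) && (ty y == nbh [:: 3; 5; 6])]; last first.
  exists cover_no_356 => // x xh /c356/implyP; apply.
  by have := no356 x; rewrite xh.
exists cover_both => // x xh /cboth/implyP xboth.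
(* [ty_good2] compares distinct vertices, so [x = y] and [x = z] are settled directly: both special
   types occur in [cover_both]. *)
have [->|xy] := eqVneq x y; first by rewrite yt.
have [->|xz] := eqVneq x z; first by rewrite zt.
apply: xboth; rewrite -yt -zt; apply/andP; split.
  exact: (has_bool (good2 (ty y) (ty x)) _ (ty_good2 yh xh xy)).
exact: (has_bool (good2 (ty z) (ty x)) _ (ty_good2 zh xh xz)).
Qed.

Definition W0 : {set G} := [set x | (x \notin hs) && (ty x \in W_types)].

Lemma W0_cover : exists (X : {set G}) s, [/\ X \subset W0, stable X, all (@clique G) s,
  covers s W0 & size s = #|X|].
Proof.
have W0P x : x \in W0 -> x \notin hs /\ ty x \in W_types.
  by rewrite [x \in W0]inE => /andP.
apply: reducible_cover (subxx W0) => W.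
apply: (@matching_reducible G _ W0 ty (nbh [::]) (nbh [:: 0; 2; 5]) (behead W_types)) => //.
- by move=> x /W0P[].
- move=> x y /W0P[xh xW] /W0P[yh yW] xy.
  have yx : y != x by apply: contraTneq xy => ->; rewrite adj_irr.
  apply: contraTneq (ty_good2 xh yh yx) => <-; rewrite adj_sym xy.
  exact: allP good2_W_stable _ xW.
- move=> x y z /W0P[xh xW] /W0P[yh yW] /W0P[zh zW] xy xz yz.
  apply/eqP/negPn/negP=> nyz.
  have yx : y != x by apply: contraTneq xy => ->; rewrite adj_irr.
  have zx : z != x by apply: contraTneq xz => ->; rewrite adj_irr.
  (* Vertices of equal type are nonadjacent, so [good3_W_matching] will apply. *)
  have nadj_yz : adj z y = false.
    apply/negP=> zy; have := ty_good2 yh zh; rewrite zy -yz eq_sym => /(_ nyz).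
    by apply/negP; apply: allP good2_W_stable _ yW.
  have := ty_good3 xh yh zh yx zx; rewrite eq_sym => /(_ nyz).
  rewrite nadj_yz -yz [adj y x]adj_sym xy [adj z x]adj_sym xz; apply/negP.
  by have /allP/(_ _ yW) := allP good3_W_matching _ xW.
- move=> x y /W0P[xh xW] /W0P[yh yW] xy xt.
  have yx : y != x by apply: contraTneq xy => ->; rewrite adj_irr.
  have /implyP := allP good2_W_empty _ yW; rewrite -xt => H.
  by apply/eqP/H; have := ty_good2 xh yh yx; rewrite adj_sym xy.
Qed.

(** Five classes and [#|X|] cliques cover [G], while [X] with two more vertices is stable. *)
Lemma clique_cover_number_bound :
  clique_cover_number G <= stability_number G + 3.
Proof.
have [X [s [XW Xst sC sW sX]]] := W0_cover.
have [cs csin csT] := five_classes.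
have cs5 : size cs = 5.
  by move: csin; rewrite !inE => /or3P[] /eqP->.
have csC : all (@clique G) (map class_set cs).
  rewrite all_map; apply: sub_all (allP good_covers _ csin).
  exact: clique_class_set.
have csB := allP covers_base _ csin.
have cover_all : covers (map class_set cs ++ s) [set: G].
  move=> x _; rewrite has_cat has_map.
  have [xh|xh] := boolP (x \in hs).
    have /(allP csB)/hasP[c cc xc] : index x hs \in iota 0 7.
      by rewrite mem_iota -size_hs index_mem.
    by apply/orP; left; apply/hasP; exists c; rewrite //= inE xh.
  have := ty_types xh; rewrite mem_cat => /orP[xW|/(csT _ xh)/hasP[c cc xc]].
    by rewrite sW ?orbT // inE xh.
  by apply/orP; left; apply/hasP; exists c; rewrite //= inE (negbTE xh).
have := clique_cover_number_le _ cover_all; rewrite all_cat csC sC.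
move=> /(_ isT) /leq_trans; apply.
rewrite size_cat size_map cs5 sX -[5]/(2 + 3) addnAC leq_add2r.
(* Indices 1 and 3 are opposite vertices of the 4-cycle, and no type in [W_types] contains
   either. *)
pose v2 := nth x0 hs 1; pose v4 := nth x0 hs 3.
have v2h : v2 \in hs by rewrite mem_nth ?size_hs.
have v4h : v4 \in hs by rewrite mem_nth ?size_hs.
have v24 : v2 != v4 by rewrite nth_uniq ?size_hs.
have hX v : v \in hs -> v \notin X.
  by move=> vh; apply: contraL vh => /(subsetP XW); rewrite inE => /andP[].
have nadj24 : adj v2 v4 = false by rewrite adj_hs.
have WX x : x \in X -> (adj x v2 = false) * (adj x v4 = false).
  move/(subsetP XW); rewrite inE => /andP[_ xW].
  rewrite -!nth_ty //; split; apply: negbTE.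
    by apply: (allP (_ : all (fun t => ~~ nth false t 1) W_types)) xW.
  by apply: (allP (_ : all (fun t => ~~ nth false t 3) W_types)) xW.
have := @stability_number_ge G (v2 |: (v4 |: X)).
rewrite !cardsU1 !inE negb_or v24 !hX //= addnA; apply.
apply/stableP=> x y; rewrite !inE.
case/or3P=> [/eqP->|/eqP->|xX] /or3P[/eqP->|/eqP->|yX];
  rewrite ?adj_irr ?nadj24 ?(WX _ xX) //.
- by rewrite adj_sym (WX _ yX).
- by rewrite adj_sym nadj24.
- by rewrite adj_sym (WX _ yX).
by move/stableP: Xst; apply.
Qed.

End Free.

(** * From an induced [H1] to a sequence of vertices *)

Theorem theorem3p2 (G : sgraph) :
  ~ has_induced G P2_P3 ->
  ~ has_induced G (compl P2_P3) ->
  ~ has_induced G K2_K3 ->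
  has_induced G H1 ->
  clique_cover_number G <= stability_number G + 3.
Proof.
move=> f1 f2 f3 [S [f [g fK gK] fE]].
(* [g] inverts the isomorphism onto [H1], so [h] embeds [H1] in [G]. *)
pose h (x : H1) : G := val (g x).
have hE x y : adj (h x) (h y) = adj x y by rewrite -{2}(gK x) -{2}(gK y) fE.
apply: (@clique_cover_number_bound G (h ord0) (map h H1_vertices)) => //.
  by rewrite map_inj_uniq // => x y /val_inj /(can_inj gK).
exact: (@tri_map _ _ (@adj H1) _ _ predT [::]).
Qed.
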